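(* For every $a\in\mathbb{R}$, $$\mathbb{P}\big(S(t)\le a\ \text{for all } t\in[0,1]\big)=\Phi(a)^2-a\,\phi(a)\Phi(a)-\phi(a)^2 .$$
   Context: $S(t)=B(t+1)-B(t)$, $t\in[0,1]$, where $B$ is a standard Brownian motion (the Slepian process). $\phi(x)=\frac{1}{\sqrt{2\pi}}e^{-x^2/2}$ is the standard normal density and $\Phi(x)=\int_{-\infty}^x\phi(s)\,ds$ the standard normal distribution function. *)

(* Defs.v *)
From HB Require Import structures.
From mathcomp Require Import all_boot all_order all_algebra.
From mathcomp Require Import all_classical all_reals all_analysis.
Set Implicit Arguments. Unset Strict Implicit. Unset Printing Implicit Defensive.
Import Order.TTheory GRing.Theory Num.Theory.
Import numFieldNormedType.Exports.
Local Open Scope classical_set_scope.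
Local Open Scope ring_scope.

Definition std_phi {R : realType} (x : R) : R :=
  (Num.sqrt (pi *+ 2))^-1 * expR (- (x ^+ 2) / 2).

Definition std_Phi {R : realType} (x : R) : R :=
  fine (\int[lebesgue_measure]_(s in `]-oo, x]) (std_phi s)%:E)%E.

(* A standard Brownian motion (B t)_{t >= 0} on the probability space (T, P):
   - each B t is a random variable;
   - B 0 = 0 and every path t |-> B t w is continuous on [0, +oo);
   - for 0 <= s < t, B t - B s is N(0, t - s) distributed
     (normal_prob m sigma has mean m and standard deviation sigma);
   - increments over consecutive intervals 0 <= t_0 < t_1 < ... < t_n are
     mutually independent (product rule for all Borel/measurable sets). *)
Definition is_std_brownian {R : realType} {d : measure_display}
  {T : measurableType d} (P : probability T R) (B : R -> T -> R) : Prop :=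
  [/\ (forall t, measurable_fun setT (B t)),
      (forall w, B 0 w = 0),
      (forall w, {within `[0, +oo[, continuous (fun t => B t w)}),
      (forall s t, 0 <= s -> s < t -> forall A : set R, measurable A ->
          P [set w | A (B t w - B s w)] = normal_prob 0 (Num.sqrt (t - s)) A) &
      (forall (n : nat) (t : nat -> R), 0 <= t 0%N ->
          (forall i, (i < n)%N -> t i < t i.+1) ->
          forall A : nat -> set R, (forall i, measurable (A i)) ->
          P [set w | forall i, (i < n)%N -> A i (B (t i.+1) w - B (t i) w)] =
          (\prod_(i < n) P [set w | A i (B (t i.+1) w - B (t i) w)%R])%E)].

(* Main.v *)
(* Let V(t) = S(t) - S(0).  Swapping the increments of B over [t, 1] with those
   over [t + 1, 2], where t is the time at which V first exceeds a level m,
   preserves the law of B and maps the pair (S(0), S(1))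
   to (S(1) - m, S(0) + m), up to the overshoot of the level.  The endpoints
   S(0) and S(1) are independent standard normal variables.  On the slice
   u < S(0) <= u + e, with S(1) <= a, the path exceeds a when V exceeds about
   m = a - u, and the reflected event is then S(1) in (a, a + e], S(0) <= u up to
   small errors, of probability about e phi(a) Phi(u).  Summing over slices,
     P(S(0) <= a, S(1) <= a, sup S > a) = phi(a) int_{-oo}^a Phi
                                        = phi(a) (a Phi(a) + phi(a)),
   to be subtracted from P(S(0) <= a, S(1) <= a) = Phi(a)^2.  The reflection is
   carried out on the grid k/N, where it is a permutation of the 2N independent,
   identically distributed increments of B. *)
Require Import Defs.
From HB Require Import structures.
From mathcomp Require Import all_boot all_order all_algebra.
From mathcomp Require Import all_classical all_reals all_analysis.
From mathcomp Require Import measurable_realfun ring lra zify.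
Import Order.TTheory GRing.Theory Num.Theory.
Import numFieldNormedType.Exports.
Local Open Scope classical_set_scope.
Local Open Scope ring_scope.
Set Implicit Arguments.
Unset Strict Implicit.
Unset Printing Implicit Defensive.

(** * Standard normal density and distribution function: Lipschitz bounds, primitive, left tails *)

Section gaussian.
Context {R : realType}.
Implicit Types (x y u v e : R).
Local Notation phi := (@std_phi R).
Local Notation Phi := (@std_Phi R).

Lemma std_phiE : phi = normal_pdf 0 1.
Proof.
apply/funext => x; rewrite normal_pdfE ?oner_neq0// /std_phi.
by rewrite /normal_peak /normal_fun expr1n mul1r subr0.
Qed.

Lemma std_PhiE x : normal_prob 0 1 `]-oo, x] = (Phi x)%:E.
Proof.
rewrite /std_Phi fineK; first by rewrite /normal_prob std_phiE.
have := fin_num_measure (normal_prob 0 1 : probability _ R) `]-oo, x]%classic.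
by rewrite std_phiE; apply; exact: measurable_itv.
Qed.

Lemma std_phi_ge0 x : 0 <= phi x.
Proof. by rewrite std_phiE normal_pdf_ge0. Qed.

Lemma std_phi_le_expR x : phi x <= expR (- (x ^+ 2) / 2).
Proof.
have pi2 : 1 <= Num.sqrt (pi *+ 2) :> R.
  rewrite -[leLHS]sqrtr1 ler_wsqrtr// mulr2n.
  by have := @pi_ge2 R; lra.
rewrite /std_phi ler_piMl ?expR_ge0// invf_le1//.
exact: lt_le_trans pi2.
Qed.

Lemma std_phi_le1 x : phi x <= 1.
Proof.
apply: le_trans (std_phi_le_expR x) _; rewrite -[leRHS]expR0 ler_expR.
by have := sqr_ge0 x; lra.
Qed.

(* From [exp t >= 1 + t] at [t = x^2/2]. *)
Lemma std_phi_le_inv x : (1 + x ^+ 2 / 2) * phi x <= 1.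
Proof.
have t0 : 0 <= x ^+ 2 / 2 by rewrite divr_ge0// sqr_ge0.
have h1 := expR_ge1Dx (x ^+ 2 / 2).
apply: (@le_trans _ _ ((1 + x ^+ 2 / 2) * expR (- (x ^+ 2 / 2)))).
  by rewrite ler_wpM2l ?addr_ge0// -mulNr std_phi_le_expR.
by rewrite expRN -ler_pdivlMr ?invr_gt0 ?expR_gt0// invrK mul1r.
Qed.

Lemma is_derive_std_phi x : is_derive x 1 phi (- x * phi x).
Proof.
rewrite (_ : phi = (Num.sqrt (pi *+ 2))^-1 \*:
    (expR \o ((- 2^-1) \*: (@idfun R ^+ 2) : R -> R)) :> (R -> R)); last first.
  apply/funext => y; rewrite /std_phi /= [in RHS]/GRing.scale /= exprfctE.
  by congr (_ * expR _); rewrite mulNr mulrC mulNr.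
apply: is_derive_eq => /=.
rewrite /GRing.scale /=; move: (expR _) (_^-1) => p q.
by field.
Qed.

(** Since [(|x| - 1)^2 >= 0], [|x| <= 1 + x^2/2], and [std_phi_le_inv] applies. This makes [phi]
    1-Lipschitz. *)
Lemma std_phi_norm_derive_le1 x : `|- x * phi x| <= 1.
Proof.
rewrite normrM normrN [`|phi x|]ger0_norm ?std_phi_ge0//.
apply: le_trans (std_phi_le_inv x); rewrite ler_wpM2r ?std_phi_ge0//.
by rewrite -(real_normK (num_real x)); have := sqr_ge0 (`|x| - 1); nra.
Qed.

Lemma is_derive_continuous (F : R -> R) (f : R -> R) :
  (forall z : R, is_derive z (1 : R) F (f z)) -> continuous F.
Proof.
move=> Ff z; apply: differentiable_continuous.
by apply/derivable1_diffP; have [] := Ff z.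
Qed.

Lemma is_derive_MVT (F f : R -> R) u v : u <= v ->
  (forall z : R, is_derive z (1 : R) F (f z)) ->
  exists2 c, u <= c <= v & F v - F u = f c * (v - u).
Proof.
move=> uv Ff; have [] := @MVT_segment R F f u v uv (fun z _ => Ff z).
  by apply: continuous_subspaceT; exact: is_derive_continuous Ff.
by move=> c; rewrite in_itv/= => cuv h; exists c.
Qed.

Lemma std_phi_lipschitz u v : `|phi u - phi v| <= `|u - v|.
Proof.
wlog uv : u v / u <= v => [H|].
  by case/orP: (le_total u v) => /H//; rewrite distrC [`|v - u|]distrC.
have [c _ h] := is_derive_MVT uv is_derive_std_phi.
rewrite distrC h [`|u - v|]distrC normrM ler_piMl//.
exact: std_phi_norm_derive_le1.
Qed.

Lemma is_derive_std_Phi x : is_derive x 1 Phi (phi x).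
Proof.
have x1 : x < x + 1 by rewrite ltrDl.
(* The upper endpoint [x + 1] only serves to put [x] in the interior of the domain of
   integration. *)
have [|||dPhi Phi'] := @continuous_FTC1 R phi -oo%O x (x + 1) x1.
- apply: (@integrableS _ _ _ _ setT) => //.
  by rewrite std_phiE; exact: integrable_normal_pdf.
- by rewrite ltNyr.
- by rewrite std_phiE; apply: continuous_normal_pdf; rewrite oner_neq0.
by apply: DeriveDef; [exact: dPhi|rewrite -derive1E].
Qed.

Lemma std_Phi_ge0 x : 0 <= Phi x.
Proof. by rewrite -lee_fin -std_PhiE; exact: measure_ge0. Qed.

Lemma std_Phi_le1 x : Phi x <= 1.
Proof.
rewrite -lee_fin -std_PhiE.
by apply: (@probability_le1 _ _ _ (normal_prob 0 1)); exact: measurable_itv.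
Qed.

Lemma std_PhiB_itv u v : u <= v ->
  exists2 c, u <= c <= v & Phi v - Phi u = phi c * (v - u).
Proof. by move=> uv; exact: is_derive_MVT uv is_derive_std_Phi. Qed.

Lemma std_Phi_le u v : u <= v -> Phi u <= Phi v.
Proof.
move=> uv; have [c _ h] := std_PhiB_itv uv.
by rewrite -subr_ge0 h mulr_ge0 ?std_phi_ge0// subr_ge0.
Qed.

Lemma std_PhiB_le u v : u <= v -> Phi v - Phi u <= v - u.
Proof.
move=> uv; have [c _ ->] := std_PhiB_itv uv.
by rewrite ler_piMl ?std_phi_le1// subr_ge0.
Qed.

(** By parts, this is the integral of [Phi] over []-oo, x]]. *)
Definition std_Phi_prim x := x * Phi x + phi x.
Local Notation G := std_Phi_prim.

Lemma is_derive_std_Phi_prim x : is_derive x 1 G (Phi x).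
Proof.
rewrite (_ : G = (@idfun R * Phi + phi :> (R -> R)))//.
have := is_derive_std_phi x; have := is_derive_std_Phi x => ? ?.
by apply: is_derive_eq; rewrite /GRing.scale /=; ring.
Qed.

(** Compares one term of a Riemann sum of [Phi] with an increment of its primitive; summed over
    slices, these increments telescope. *)
Lemma std_Phi_primB u e : 0 <= e ->
  e * Phi u <= G (u + e) - G u <= e * Phi (u + e).
Proof.
move=> e0; have ue : u <= u + e by rewrite lerDl.
have [c /andP[uc ce] ->] := is_derive_MVT ue is_derive_std_Phi_prim.
by rewrite addrAC subrr add0r [Phi c * e]mulrC !ler_wpM2l ?std_Phi_le.
Qed.

Section cdf.
(** Under [normal_prob 0 1] the identity is a random variable with distribution function [Phi], so
    the general limit of a cdf at -oo applies to [Phi]. *)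
Let idTR : measurableTypeR R -> R := idfun.

#[local] HB.instance Definition _ :=
  @isMeasurableFun.Build _ _ _ _ idTR (@measurable_id _ _ setT).

Lemma std_Phi_cvgNy0 : Phi @ -oo --> (0 : R).
Proof.
suff H : (Phi x)%:E @[x --> -oo] --> (0 : R)%:E by exact: (fine_cvg H).
have := @cvg_cdfNy0 _ _ _ (normal_prob 0 1 : probability (measurableTypeR R) R)
  (idTR : {RV (normal_prob 0 1 : probability (measurableTypeR R) R) >-> R}).
apply: cvg_trans; apply: near_eq_cvg; apply: nearW => x.
by rewrite /= -std_PhiE /cdf /distribution /pushforward preimage_id.
Qed.

End cdf.

Lemma std_Phi_small e : 0 < e -> exists y, forall x, x <= y -> Phi x <= e.
Proof.
move=> e0; have /cvgrPdist_le/(_ _ e0)[A [_ HA]] := std_Phi_cvgNy0.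
exists (A - 1) => x xA; have /HA : x < A by lra.
by rewrite /= sub0r normrN; exact/le_trans/ler_norm.
Qed.

(* On [y, x] the derivative [(x - s) * phi s] of
   [s |-> phi s + x * Phi s] is nonnegative; let y tend to -oo. *)
Lemma std_Phi_mills x : - x * Phi x <= phi x.
Proof.
have [x0|x0] := leP 0 x.
  by rewrite (@le_trans _ _ 0) ?std_phi_ge0// mulNr oppr_le0 mulr_ge0 ?std_Phi_ge0.
have K z : is_derive z (1 : R) (phi + x \*: Phi) ((x - z) * phi z).
  have := is_derive_std_phi z; have := is_derive_std_Phi z => ? ?.
  by apply: is_derive_eq; rewrite /GRing.scale /=; ring.
have H y : y <= x -> - x * (Phi x - Phi y) <= phi x.
  move=> yx; have [c /andP[_ cx]] := is_derive_MVT yx K.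
  have E w : (phi + x \*: Phi) w = phi w + x * Phi w by [].
  rewrite !E => h.
  have : 0 <= (x - c) * phi c * (x - y).
    by rewrite !mulr_ge0 ?std_phi_ge0 ?subr_ge0.
  by rewrite -h; have := std_phi_ge0 y; lra.
apply/ler_addgt0Pr => e e0.
have [|y Hy] := @std_Phi_small (e / - x); first by rewrite divr_gt0// oppr_gt0.
have /H : Num.min x y <= x by rewrite ge_min lexx.
have /Hy : Num.min x y <= y by rewrite ge_min lexx orbT.
rewrite ler_pdivlMr ?oppr_gt0//.
lra.
Qed.

Lemma std_Phi_prim_ge0 x : 0 <= G x.
Proof. by have := std_Phi_mills x; rewrite /std_Phi_prim; lra. Qed.

(** For [x <= 0] the term [x * Phi x] is nonpositive, so [G x <= phi x]. Moreover
    [- x * phi x <= 1], hence [2 * phi x <= e] as soon as [- x * e >= 2]. *)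
Lemma std_Phi_prim_small e : 0 < e -> exists y, forall x, x <= y -> G x <= e.
Proof.
move=> e0; exists (Num.min 0 (- (2 / e))) => x.
rewrite le_min => /andP[x0 xe].
apply: (@le_trans _ _ (phi x)).
  by rewrite /std_Phi_prim gerDr mulr_le0_ge0 ?std_Phi_ge0//.
have h := std_phi_le_inv x.
have h0 := std_phi_ge0 x.
have xe2 : 2 <= - x * e by rewrite -ler_pdivrMr//; lra.
have : phi x * 2 <= (- x * e) * phi x by rewrite mulrC ler_wpM2r.
have : - x <= (1 + x ^+ 2 / 2) by have := sqr_ge0 (x + 1); rewrite sqrrD; lra.
move/(ler_wpM2r h0) => h3.
have : e * (- x * phi x) <= e * 1.
  by rewrite (ler_wpM2l (ltW e0))//; exact: le_trans h3 h.
by lra.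
Qed.

End gaussian.

(** * Continuous functions on [0, 1] sampled on the grid k/N *)

Section grid.
Context {R : realType}.
Variable f : R -> R.
Hypothesis cf : {within `[0, 1], continuous f}.

(** Heine's theorem, from compactness in its near-covering form, with the filter of radii [d]
    tending to 0 from the right. *)
Lemma unit_itv_unif_continuous (eta : R) : 0 < eta -> exists2 delta, 0 < delta &
  forall s t, 0 <= s <= 1 -> 0 <= t <= 1 -> `|s - t| < delta -> `|f s - f t| <= eta.
Proof.
move=> eta0.
have := @segment_compact R 0 1 => /compact_near_coveringP.
move=> /(_ R (0^'+) (fun d x => 0 <= x <= 1 -> forall s, 0 <= s <= 1 ->
  `|s - x| < d -> `|f s - f x| <= eta) _).
case=> [x /= xI|d /= d0 H].
  have /subspace_continuousP/(_ x xI) := cf => /cvgrPdist_le/(_ (eta / 2)).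
  rewrite divr_gt0// => /(_ isT) [r /= r0 Hr].
  have r20 : 0 < r / 2 by rewrite divr_gt0.
  (* Half of [r] goes to the distance from [x] to [y] and half to that from [y] to [s], so both [y]
     and [s] lie within [r] of [x]. *)
  exists (ball x (r / 2), [set d | d < r / 2]).
    split; first exact: nbhsx_ballx.
    exact: nbhs_right_lt.
  case=> y d [/= xy dr] yI s sI sy.
  have h1 : `|f x - f y| <= eta / 2.
    apply: Hr; first by move: xy; rewrite -ball_normE /ball_ /=; lra.
    by rewrite in_itv.
  have h2 : `|f x - f s| <= eta / 2.
    apply: Hr; last by rewrite in_itv.
    move: xy; rewrite -ball_normE /= => xy.
    rewrite /ball_ /= (le_lt_trans (ler_distD y _ _))//.
    by rewrite [`|y - s|]distrC; lra.
  rewrite (le_trans (ler_distD (f x) _ _))// [`|f s - _|]distrC; lra.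
exists (d / 2); first by rewrite divr_gt0.
move=> s t sI tI st; have := H (d / 2); apply => //.
  by rewrite /ball_ /= sub0r normrN gtr0_norm; lra.
by rewrite divr_gt0.
Qed.

Lemma grid_oscillation (eta : R) : 0 < eta ->
  \forall N \near \oo, forall k, (k < N)%N ->
    `|f (k.+1%:R / N%:R) - f (k%:R / N%:R)| <= eta.
Proof.
move=> /unit_itv_unif_continuous[delta delta0 H].
near=> N => k kN.
have N0 : 0 < N%:R :> R by rewrite ltr0n (leq_ltn_trans _ kN).
apply: H.
- by rewrite divr_ge0//= ler_pdivrMr// mul1r ler_nat.
- by rewrite divr_ge0//= ler_pdivrMr// mul1r ler_nat ltnW.
rewrite -mulrBl -natrB// subSnn ger0_norm ?divr_ge0//.
rewrite ltr_pdivrMr// mulrC -ltr_pdivrMr// div1r.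
near: N; exact: nbhs_infty_gtr.
Unshelve. all: end_near. Qed.

(** The grid point [truncn (t * N) / N] is within 1/N of [t], and for large [N] the function drops
    there by at most half of the gap [f t - m]. *)
Lemma grid_exceed (m t : R) : 0 <= t <= 1 -> m < f t ->
  \forall N \near \oo, exists2 k, (k <= N)%N & m < f (k%:R / N%:R).
Proof.
move=> /andP[t0 t1] mt.
have eta0 : 0 < (f t - m) / 2 by rewrite divr_gt0// subr_gt0.
have [delta delta0 H] := unit_itv_unif_continuous eta0.
near=> N; have N0 : 0 < N%:R :> R.
  by rewrite ltr0n; near: N; exact: nbhs_infty_gt.
have tN0 : 0 <= t * N%:R by rewrite mulr_ge0// ltW.
have /andP[kt tk] := truncn_itv tN0.
have kN : (Num.truncn (t * N%:R) <= N)%N.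
  by rewrite -(ler_nat R) (le_trans kt)// ler_piMl// ltW.
exists (Num.truncn (t * N%:R)) => //.
move: kt tk kN; move: (Num.truncn _) => k kt tk kN.
suff /ler_normlP [] : `|f t - f (k%:R / N%:R)| <= (f t - m) / 2 by lra.
apply: H; rewrite ?t0//.
  by rewrite divr_ge0//= ler_pdivrMr// mul1r ler_nat.
have -> : t - k%:R / N%:R = (t * N%:R - k%:R) / N%:R.
  by rewrite mulrBl mulfK// gt_eqF.
rewrite ger0_norm ?divr_ge0 ?subr_ge0//.
apply: (@lt_trans _ _ (N%:R^-1)).
  by rewrite ltr_pdivrMr// mulVf ?gt_eqF//; move: tk; rewrite -natr1; lra.
rewrite invf_plt ?posrE//; near: N; exact: nbhs_infty_gtr.
Unshelve. all: end_near. Qed.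

End grid.

(** * Measurability of events defined by inequalities *)

Section measurable_comparison.
Context d (T : measurableType d) (R : realType).
Implicit Types f g : T -> R.

Lemma measurable_set_lt f g : measurable_fun setT f -> measurable_fun setT g ->
  measurable [set x | f x < g x].
Proof.
by move=> mf mg; have := measurable_fun_ltr mf mg measurableT (I : measurable [set true]); rewrite setTI.
Qed.

Lemma measurable_set_le f g : measurable_fun setT f -> measurable_fun setT g ->
  measurable [set x | f x <= g x].
Proof.
by move=> mf mg; have := measurable_fun_ler mf mg measurableT (I : measurable [set true]); rewrite setTI.
Qed.

Lemma measurable_set_forall (P : nat -> Prop) (F : nat -> T -> Prop) :
  (forall i, P i -> measurable [set x | F i x]) ->
  measurable [set x | forall i, P i -> F i x].
Proof.
exact: (@bigcap_measurableType _ _ (fun i => [set x | F i x]) P).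
Qed.

End measurable_comparison.

(** * Laws of finite families of variables and exchangeability of i.i.d. ones *)

Section exchangeable.
Context {R : realType}.

(** The pi-system of cylinders with measurable sides in the first [M] coordinates. The sigma-algebra
    it generates on infinite sequences, that of [pathspace M], sees only these coordinates. *)
Definition box (M : nat) : set (set (nat -> R)) :=
  [set C | exists2 A : nat -> set R, (forall i, measurable (A i)) &
                                    C = [set x | forall i, (i < M)%N -> A i (x i)]].

Lemma setI_closed_box M : setI_closed (box M).
Proof.
move=> _ _ [A mA ->] [A' mA' ->]; exists (fun i => A i `&` A' i).
  by move=> i; exact: measurableI.
apply/seteqP; split => [x /= [H H'] i iM|x /= H]; first by split; auto.
by split => i /H[].
Qed.

Lemma box_setT M : box M setT.
Proof. by exists (fun=> setT) => //; apply/seteqP; split. Qed.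

Notation pathspace M := (g_sigma_algebraType (box M)).

Lemma measurable_coordinate M i : (i < M)%N ->
  measurable_fun setT (fun x : pathspace M => x i).
Proof.
move=> iM _ Y mY; rewrite setTI; apply: sub_sigma_algebra.
exists (fun j => if j == i then Y else setT); first by move=> j; case: ifP.
apply/seteqP; split => [x /= xY j _|x /= /(_ i iM)]; last by rewrite eqxx.
by case: eqP => // ->.
Qed.

Context d (T : measurableType d) (P : probability T R).

Lemma measurable_path M (X : nat -> T -> R) :
  (forall i, measurable_fun setT (X i)) ->
  measurable_fun setT (fun w => (fun i => X i w) : pathspace M).
Proof.
move=> mX; apply: (@measurability _ _ T (pathspace M) setT (fun w i => X i w) (box M)) => // _ [_ [A mA ->] <-].
rewrite setTI; apply: measurable_set_forall => i _.
by rewrite -[X in measurable X]setTI; exact: mX.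
Qed.

(** The two laws are finite measures on [pathspace M] that agree on the generating pi-system of
    boxes, so they coincide. *)
Lemma path_law_unique M (X Y : nat -> T -> R) :
  (forall i, measurable_fun setT (X i)) ->
  (forall i, measurable_fun setT (Y i)) ->
  (forall A : nat -> set R, (forall i, measurable (A i)) ->
    P [set w | forall i, (i < M)%N -> A i (X i w)] =
    P [set w | forall i, (i < M)%N -> A i (Y i w)]) ->
  forall C : set (pathspace M), measurable C ->
  P [set w | C (fun i => X i w)] = P [set w | C (fun i => Y i w)].
Proof.
move=> /measurable_path mX /measurable_path mY XY C mC.
pose mu (Z : T -> pathspace M) mZ : {measure set (pathspace M) -> \bar R} :=
  measure_function_pushforward__canonical__measure_function_Measure P
    (mZ : measurable_fun setT Z).
have := @measure_unique _ R (pathspace M) (box M) (fun=> setT) erefl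
  (@setI_closed_box M) (fun=> box_setT M) _ (mu _ (mX M)) (mu _ (mY M)).
apply => //.
- by apply/seteqP; split => // x _; exists 0%N.
- by move=> _ [A mA ->]; exact: XY.
by move=> _; exact: le_lt_trans (probability_le1 P measurableT) (ltry 1).
Qed.

Context (M : nat) (X : nat -> T -> R) (mu : set R -> \bar R).
Hypothesis mX : forall i, measurable_fun setT (X i).
Hypothesis X_iid : forall A : nat -> set R, (forall i, measurable (A i)) ->
  P [set w | forall i, (i < M)%N -> A i (X i w)] = (\prod_(i < M) mu (A i))%E.

(** It suffices to compare boxes. Permuting the variables amounts to permuting the sides of the box,
    which only reorders the product of the [mu (A i)]. *)
Lemma iid_exchangeable (s : nat -> nat) (C : set (pathspace M)) :
  involutive s -> (forall i, (i < M)%N -> (s i < M)%N) -> measurable C ->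
  P [set w | C (fun i => X i w)] = P [set w | C (fun i => X (s i) w)].
Proof.
move=> sK sM; apply: path_law_unique => // A mA.
rewrite X_iid//.
have -> : [set w | forall i, (i < M)%N -> A i (X (s i) w)] =
    [set w | forall i, (i < M)%N -> A (s i) (X i w)].
  apply/seteqP; split => w /= H i /[dup] iM /sM /H; first by rewrite sK.
  by rewrite sK.
rewrite (X_iid (fun i => mA (s i))).
pose s' (i : 'I_M) := Ordinal (sM i (ltn_ord i)).
rewrite (reindex s')//=.
by exists s' => i _; apply: val_inj; rewrite /= sK.
Qed.

End exchangeable.

(** * Discrete reflection: swapping increments after the first exceedance *)

Section reflection.
Context {R : realType}.
Implicit Types (x : nat -> R) (m u v a : R).

(* Exchanges [i] and [N + i] for [k <= i < N]. *)
Definition swap N k i : nat :=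
  if (k <= i < N)%N then (N + i)%N
  else if (N + k <= i < N + N)%N then (i - N)%N else i.

Lemma swapK N k : involutive (swap N k).
Proof.
move=> i; rewrite /swap.
by case: (ifP (k <= i < N)%N) => h1; [|case: (ifP (N + k <= i < N + N)%N) => h2];
  repeat case: ifP => ?; lia.
Qed.

Lemma swap_lt N k i : (i < N + N)%N -> (swap N k i < N + N)%N.
Proof. by rewrite /swap; repeat case: ifP => ?; lia. Qed.

(* With [x] the increments of B over steps 1/N, [walk N x k] is S(k/N) - S(0),
   [block N x 0] is S(0) and [block N x N] is S(1). *)
Definition walk N x k : R := \sum_(i < k) (x (N + i)%N - x i).
Definition block N x j : R := \sum_(i < N) x (j + i)%N.
Definition first_exceed N m k x :=
  m < walk N x k /\ forall j, (j < k)%N -> walk N x j <= m.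

(** Up to time [k] the walk reads only the indices [i] and [N + i] with [i < k], which [swap N k]
    fixes. So the first exceedance at [k] is invariant under the swap. *)
Lemma walk_swap N k x j : (j <= k)%N -> (k <= N)%N ->
  walk N (x \o swap N k) j = walk N x j.
Proof.
move=> jk kN; apply: eq_bigr => -[i /= ij] _; congr (x _ - x _);
  by rewrite /swap; repeat case: ifP => ?; lia.
Qed.

Lemma first_exceed_swap N m k x : (k <= N)%N ->
  first_exceed N m k (x \o swap N k) <-> first_exceed N m k x.
Proof.
move=> kN; rewrite /first_exceed walk_swap//.
by split=> -[h H]; split => // j jk; have := H j jk; rewrite walk_swap// ltnW.
Qed.

(** After the swap the first block reads [x i] for [i < k] and [x (N + i)] for [k <= i < N]: this
    differs from the second block only by the first [k] steps of the walk. *)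
Lemma block0_swap N k x : (k <= N)%N ->
  block N (x \o swap N k) 0 = block N x N - walk N x k.
Proof.
move=> kN; apply/eqP; rewrite eq_sym subr_eq eq_sym; apply/eqP.
(* The walk is padded with zeros to [N] terms, so that the identity can be checked term by term. *)
rewrite /block /walk (big_ord_widen N (fun i => x (N + i)%N - x i))//.
rewrite [X in _ + X]big_mkcond -big_split /=; apply: eq_bigr => -[i /= iN] _.
rewrite add0n /swap iN andbT ltnNge; case: (leqP k i) => ki /=; first by rewrite addr0.
by case: ifP => [?|_]; [lia|rewrite addrC subrK].
Qed.

Lemma block1_swap N k x : (k <= N)%N ->
  block N (x \o swap N k) N = block N x 0 + walk N x k.
Proof.
move=> kN; rewrite /block /walk (big_ord_widen N (fun i => x (N + i)%N - x i))//.
rewrite [X in _ + X]big_mkcond -big_split /=; apply: eq_bigr => -[i /= iN] _.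
rewrite add0n /swap ltnNge; case: (leqP k i) => ki /=.
  case: ifP => [?|_]; first by lia.
  rewrite addr0; case: ifP => [_|?]; last by lia.
  by congr x; lia.
case: ifP => [?|_]; first by lia.
by case: ifP => [?|_]; [lia|rewrite addrC subrK].
Qed.

Lemma first_exceed_exists N m x k : m < walk N x k ->
  exists2 j, (j <= k)%N & first_exceed N m j x.
Proof.
elim/ltn_ind: k => k IH mk.
have [[j jk mj]|H] := pselect (exists2 j, (j < k)%N & m < walk N x j).
  by have [i ij Hi] := IH j jk mj; exists i => //; exact: leq_trans ij (ltnW jk).
exists k => //; split => // j jk; rewrite leNgt; apply/negP => mj.
by apply: H; exists j.
Qed.

Lemma first_exceed_inj N m x j k :
  first_exceed N m j x -> first_exceed N m k x -> j = k.
Proof.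
move=> [mj Hj] [mk Hk]; case: (ltngtP j k) => // [/Hk|/Hj].
  by rewrite leNgt mj.
by rewrite leNgt mk.
Qed.

Notation pathspace M := (g_sigma_algebraType (@box R M)).

Lemma measurable_walk N k : (k <= N)%N ->
  measurable_fun setT (fun x : pathspace (N + N) => walk N x k).
Proof.
move=> kN; rewrite /walk.
apply: (@measurable_sum _ _ _ _ _ _ (fun (i : 'I_k) (x : pathspace (N + N)) => _)).
by move=> -[i /= ik]; apply: measurable_funB; apply: measurable_coordinate; lia.
Qed.

Lemma measurable_block N j : (j <= N)%N ->
  measurable_fun setT (fun x : pathspace (N + N) => block N x j).
Proof.
move=> jN; rewrite /block.
apply: (@measurable_sum _ _ _ _ _ _ (fun (i : 'I_N) (x : pathspace (N + N)) => _)).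
by move=> -[i /= ik]; apply: measurable_coordinate; lia.
Qed.

(** Meant for the pair [p] = S(0), [q] = S(1). The range of [p] is half-open so that consecutive
    slices do not overlap. *)
Definition quadrant u v a (p q : R) : Prop := [/\ u < p, p <= v & q <= a].

Lemma measurable_quadrant d (T : measurableType d) u v a (f g : T -> R) :
  measurable_fun setT f -> measurable_fun setT g ->
  measurable [set w | quadrant u v a (f w) (g w)].
Proof.
move=> mf mg.
have -> : [set w | quadrant u v a (f w) (g w)] =
   [set w | cst u w < f w] `&` ([set w | f w <= cst v w] `&` [set w | g w <= cst a w]).
  by apply/seteqP; split => w /=; [case|case=> ? []; split].
apply: measurableI; first exact: measurable_set_lt.
by apply: measurableI; exact: measurable_set_le.
Qed.

Lemma measurable_first_exceed N m k : (k <= N)%N ->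
  measurable [set x : pathspace (N + N) | first_exceed N m k x].
Proof.
move=> kN.
have -> : [set x : pathspace (N + N) | first_exceed N m k x] =
   [set x : pathspace (N + N) | cst m x < walk N x k] `&`
   [set x : pathspace (N + N) | forall j, (j < k)%N -> walk N x j <= cst m x].
  by apply/seteqP; split => w /= [].
apply: measurableI; first by apply: measurable_set_lt => //; exact: measurable_walk.
apply: measurable_set_forall => j jk; apply: measurable_set_le => //.
by apply: measurable_walk; lia.
Qed.

Context d (T : measurableType d) (P : probability T R).
Context (N : nat) (X : nat -> T -> R) (mu : set R -> \bar R).
Hypothesis mX : forall i, measurable_fun setT (X i).
Hypothesis X_iid : forall A : nat -> set R, (forall i, measurable (A i)) ->
  P [set w | forall i, (i < N + N)%N -> A i (X i w)] =
  (\prod_(i < N + N) mu (A i))%E.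
Local Notation Xw w := (fun i => X i w).

Lemma measurable_path_event (C : set (pathspace (N + N))) :
  measurable C -> measurable [set w | C (Xw w)].
Proof.
move=> mC; have := measurable_path (M := N + N) mX measurableT mC.
by rewrite setTI.
Qed.

(** The swap depends on the random index of first exceedance. Splitting according to its value [k]
    leaves a fixed permutation on each piece, which preserves the law of the increments; the pieces
    are disjoint, so their probabilities add up. *)
Lemma reflection u v a m :
  P [set w | exists2 k, (k <= N)%N & first_exceed N m k (Xw w) /\
       quadrant u v a (block N (Xw w) 0) (block N (Xw w) N)] =
  P [set w | exists2 k, (k <= N)%N & first_exceed N m k (Xw w) /\
       quadrant u v a (block N (Xw w) N - walk N (Xw w) k)
                      (block N (Xw w) 0 + walk N (Xw w) k)].
Proof.
pose F k (x : pathspace (N + N)) := first_exceed N m k x /\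
  quadrant u v a (block N x 0) (block N x N).
pose F' k (x : pathspace (N + N)) := first_exceed N m k x /\
  quadrant u v a (block N x N - walk N x k) (block N x 0 + walk N x k).
have mF k : (k <= N)%N -> measurable (F k).
  move=> kN; apply: measurableI; first exact: measurable_first_exceed.
  by apply: measurable_quadrant; apply: measurable_block.
have mF' k : (k <= N)%N -> measurable (F' k).
  move=> kN; apply: measurableI; first exact: measurable_first_exceed.
  apply: measurable_quadrant; [apply: measurable_funB|apply: measurable_funD];
    by [exact: measurable_block|exact: measurable_walk].
have FF' k : (k <= N)%N -> P [set w | F k (Xw w)] = P [set w | F' k (Xw w)].
  move=> kN; rewrite (iid_exchangeable mX X_iid (@swapK N k) (@swap_lt N k) (mF k kN)).
  congr (P _); apply/seteqP; split => w.
    move=> [/(first_exceed_swap m (Xw w) kN) h].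
    by rewrite (block0_swap (Xw w) kN) (block1_swap (Xw w) kN) => H; split.
  move=> [h H]; split; first exact/(first_exceed_swap m (Xw w) kN).
  by rewrite (block0_swap (Xw w) kN) (block1_swap (Xw w) kN).
(* A first exceedance index is unique, hence the union over [k <= N] is disjoint and its measure is
   a sum. *)
have U (G : nat -> set (pathspace (N + N))) :
    (forall k, (k <= N)%N -> measurable (G k)) ->
    (forall k x, G k x -> first_exceed N m k x) ->
    P [set w | exists2 k, (k <= N)%N & G k (Xw w)] =
    \big[adde/0%E]_(0 <= k <oo | k \in [set k | (k <= N)%N]) P [set w | G k (Xw w)].
  move=> mG GF.
  rewrite -(@measure_bigcup _ _ _ P [set k | (k <= N)%N]
    (fun k => [set w | G k (Xw w)])) //.
    by move=> k /= kN; apply: measurable_path_event; exact: mG.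
  apply/trivIsetP => i j _ _ ij; apply/seteqP; split => // w /= [/GF Fi /GF Fj].
  by move/eqP: ij; apply; exact: first_exceed_inj Fi Fj.
rewrite (U F) ?(U F')//; try by move=> k x [].
by apply: eq_eseriesr => k; rewrite inE; exact: FF'.
Qed.

End reflection.

(** * Real-valued probabilities: monotonicity, union bounds, events that eventually hold *)

Section probability_bounds.
Context d (T : measurableType d) (R : realType) (P : probability T R).
Implicit Types A B C : set T.

Lemma fineP_ge0 A : 0 <= fine (P A).
Proof. exact: fine_ge0. Qed.

Lemma finePK A : measurable A -> (fine (P A))%:E = P A.
Proof. by move=> mA; rewrite fineK// fin_num_measure. Qed.

Lemma fineP_le A B : measurable A -> measurable B -> A `<=` B ->
  fine (P A) <= fine (P B).
Proof.
by move=> mA mB AB; rewrite fine_le ?fin_num_measure// le_measure ?inE.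
Qed.

Lemma finePU_le A B C : measurable A -> measurable B -> measurable C ->
  A `<=` B `|` C -> fine (P A) <= fine (P B) + fine (P C).
Proof.
move=> mA mB mC ABC; rewrite -lee_fin EFinD !finePK//.
apply: le_trans (measureU2 _ mB mC).
by rewrite le_measure ?inE//; exact: measurableU.
Qed.

Lemma finePU A B : measurable A -> measurable B -> A `&` B = set0 ->
  fine (P (A `|` B)) = fine (P A) + fine (P B).
Proof.
move=> mA mB AB0; rewrite measureU// fineD// fin_num_measure//.
Qed.

(** The events that [A k] holds for all [k >= n] increase with [n] to the whole space, so continuity
    from below sends their probability to 1. *)
Lemma near_event_fineP_setC (A : nat -> set T) (e : R) :
  (forall n, measurable (A n)) -> (forall w, \forall n \near \oo, A n w) ->
  0 < e -> \forall n \near \oo, fine (P (~` A n)) <= e.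
Proof.
move=> mA Aoo e0.
pose H n := [set w | forall k, (n <= k)%N -> A k w].
have mH n : measurable (H n).
  by apply: (measurable_set_forall (P := fun k => (n <= k)%N) (F := fun k => A k)) => k _; exact: mA.
have HT : \bigcup_n H n = setT.
  by apply/seteqP; split => // w _; have [n _ Hn] := Aoo w; exists n.
have := @nondecreasing_cvg_mu _ _ _ P H mH; rewrite HT => /(_ measurableT).
have H_nd : {homo H : n m / (n <= m)%N >-> (n <= m)%O}.
  move=> n k nk; apply/subsetPset => w Hw j kj; apply: Hw.
  exact: leq_trans nk kj.
move=> /(_ H_nd) PH; have {PH} : P (H n) @[n --> \oo] --> 1%:E.
  by rewrite -(probability_setT P).
move=> /fine_cvg /cvgrPdist_le /(_ e e0).
apply: filterS => n /=; rewrite ger0_norm; last first.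
  by rewrite subr_ge0 -lee_fin finePK// probability_le1.
move=> h; apply: le_trans h; rewrite -lee_fin EFinB (finePK (mH n)).
rewrite (finePK (measurableC (mA n))).
rewrite -probability_setC//; apply: le_measure; rewrite ?inE.
- exact: measurableC.
- exact: measurableC.
- by move=> w /= nA Hw; apply: nA; exact: Hw.
Qed.

End probability_bounds.

(** * Paths of the Slepian process and their approximation on grids *)

Section slepian_paths.
Context d (T : measurableType d) (R : realType) (P : probability T R).
Context (B : R -> T -> R).
Hypothesis brownB : is_std_brownian P B.

Definition slepian w t : R := B (t + 1) w - B t w.
Local Notation S := slepian.

Lemma measurable_slepian t : measurable_fun setT (S ^~ t).
Proof. by have [mB _ _ _ _] := brownB; exact: measurable_funB. Qed.

Lemma continuous_slepian w : {within `[0, 1], continuous (S w)}.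
Proof.
have [_ _ cB _ _] := brownB; have cBw := cB w.
have {}cBw t e : 0 <= t -> 0 < e -> exists2 r, 0 < r &
    forall s, `|t - s| < r -> 0 <= s -> `|B t w - B s w| <= e.
  move=> t0 e0; have /subspace_continuousP/(_ t) := cBw.
  rewrite /= in_itv/= andbT => /(_ t0)/cvgrPdist_le/(_ e e0)[r /= r0 H].
  by exists r => // s st s0; apply: H => //; rewrite /= in_itv/= andbT.
apply/subspace_continuousP => t /=; rewrite in_itv/= => /andP[t0 t1].
apply/cvgrPdist_le => e e0; have e20 : 0 < e / 2 by rewrite divr_gt0.
have t10 : 0 <= t + 1 by rewrite addr_ge0.
have [r r0 Hr] := cBw t _ t0 e20; have [q q0 Hq] := cBw (t + 1) _ t10 e20.
exists (Num.min r q); first by rewrite /= lt_min r0.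
move=> s /=; rewrite lt_min => /andP[sr sq]; rewrite in_itv/= => /andP[s0 s1].
have h1 := Hr s sr s0.
have h2 : `|B (t + 1) w - B (s + 1) w| <= e / 2.
  by apply: Hq; [rewrite opprD addrACA subrr addr0|rewrite addr_ge0].
have -> : S w t - S w s = (B (t + 1) w - B (s + 1) w) - (B t w - B s w).
  by rewrite /slepian; ring.
by rewrite (le_trans (ler_normB _ _))//; lra.
Qed.

(** The level may be random: it is [S w 0 + m] when the excess is counted from S(0), and the
    constant [a] in the end. *)
Definition exceeds (Z : T -> R) : set T :=
  [set w | exists2 t, 0 <= t <= 1 & Z w < S w t].

Lemma unit_itv_grid N k : (k <= N)%N -> 0 <= (k%:R / N%:R : R) <= 1.
Proof.
(* For [N = 0] the quotient is 0, the inverse of 0 being 0. *)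
case: N => [|N] kN; first by rewrite invr0 mulr0 lexx ler01.
by rewrite divr_ge0//= ler_pdivrMr// mul1r ler_nat.
Qed.

Lemma measurable_exceeds_grid (Z : T -> R) N : measurable_fun setT Z ->
  measurable [set w | exists2 k, (k <= N)%N & Z w < S w (k%:R / N%:R)].
Proof.
move=> mZ; have -> : [set w | exists2 k, (k <= N)%N & Z w < S w (k%:R / N%:R)] =
    \bigcup_(k in [set k | (k <= N)%N]) [set w | Z w < S w (k%:R / N%:R)] by [].
by apply: bigcup_measurable => k _; apply: measurable_set_lt => //;
  exact: measurable_slepian.
Qed.

(** By continuity of the paths, a level that is exceeded at all is exceeded at a point of some grid;
    this leaves a countable union. *)
Lemma measurable_exceeds (Z : T -> R) : measurable_fun setT Z ->
  measurable (exceeds Z).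
Proof.
move=> mZ; have -> : exceeds Z =
    \bigcup_N [set w | exists2 k, (k <= N)%N & Z w < S w (k%:R / N%:R)].
  apply/seteqP; split => w /=.
    move=> [t tI Zt]; have [N _ HN] := grid_exceed (continuous_slepian (w := w)) tI Zt.
    by exists N => //; apply: HN => /=.
  by move=> [N _ [k kN Zk]]; exists (k%:R / N%:R) => //; exact: unit_itv_grid.
by apply: bigcupT_measurable => N; exact: measurable_exceeds_grid.
Qed.

(** The event that the grid is fine enough for the path: the first clause will bound the overshoot
    of the level, the second makes an exceedance visible on the grid. Its complement is the error
    set of the estimates below. *)
Definition fine_grid m eta N : set T :=
  [set w | (forall k, (k < N)%N ->
              `|S w (k.+1%:R / N%:R) - S w (k%:R / N%:R)| <= eta) /\
           (exceeds (fun w => S w 0 + m) w ->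
              exists2 k, (k <= N)%N & S w 0 + m < S w (k%:R / N%:R))].

Lemma measurable_fine_grid m eta N : measurable (fine_grid m eta N).
Proof.
have mS0 : measurable_fun setT (fun w => S w 0 + m).
  by apply: measurable_funD => //; exact: measurable_slepian.
apply: measurableI.
  apply: measurable_set_forall => k _; apply: measurable_set_le => //.
  apply: measurableT_comp => //; apply: measurable_funB;
  exact: measurable_slepian.
have E : ~` exceeds (fun w => S w 0 + m) `|`
    [set w | exists2 k, (k <= N)%N & S w 0 + m < S w (k%:R / N%:R)] =
    [set w | exceeds (fun w => S w 0 + m) w ->
      exists2 k, (k <= N)%N & S w 0 + m < S w (k%:R / N%:R)].
  apply/seteqP; split => w /=; first by move=> [h /h|].
  by move=> h; have [/h|] := pselect (exceeds (fun w => S w 0 + m) w); [right|left].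
suff : measurable (~` exceeds (fun w => S w 0 + m) `|`
    [set w | exists2 k, (k <= N)%N & S w 0 + m < S w (k%:R / N%:R)]).
  by rewrite E => h; exact: h.
apply: measurableU; first exact/measurableC/measurable_exceeds.
exact: measurable_exceeds_grid.
Qed.

Lemma fine_grid_fineP m eta e : 0 < eta -> 0 < e ->
  exists2 N, (0 < N)%N & fine (P (~` fine_grid m eta N)) <= e.
Proof.
move=> eta0 e0.
have : \forall N \near \oo, fine (P (~` fine_grid m eta N)) <= e.
  apply: near_event_fineP_setC => // [N|w]; first exact: measurable_fine_grid.
  have cS := continuous_slepian (w := w).
  have h1 := grid_oscillation cS eta0.
  have [[t tI mt]|nE] := pselect (exceeds (fun w => S w 0 + m) w).
    have h2 := grid_exceed cS tI mt.
    by near=> N; split; [near: N; exact: h1|move=> _; near: N; exact: h2].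
  by near=> N; split; [near: N; exact: h1|move=> /nE].
(* The successor ensures a positive number of grid steps. *)
move=> [N _ HN]; exists N.+1 => //; apply: HN => /=; exact: leqnSn.
Unshelve. all: end_near. Qed.

End slepian_paths.

(** * Law of the increments and of the endpoints; reflection for the Slepian process *)

Section slepian_law.
Context d (T : measurableType d) (R : realType) (P : probability T R).
Context (B : R -> T -> R).
Hypothesis brownB : is_std_brownian P B.
Local Notation S := (slepian B).
Local Notation pr A := (fine (P A)).

Lemma normal_prob_itv (l r : R) : l <= r ->
  normal_prob 0 1 `]l, r] = (std_Phi r - std_Phi l)%:E.
Proof.
move=> lr; pose Q : probability _ R := normal_prob (0 : R) 1.
have ml : measurable (`]-oo, l]%classic : set R) by exact: measurable_itv.
have mlr : measurable (`]l, r]%classic : set R) by exact: measurable_itv.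
have := @finePU _ _ _ Q _ _ ml mlr.
rewrite -itv_bndbnd_setU// => QU.
have {QU} : std_Phi r = std_Phi l + fine (Q `]l, r]%classic).
  have E x : fine (Q `]-oo, x]%classic) = std_Phi x by rewrite /Q/= std_PhiE.
  rewrite -!E; apply: QU; apply/seteqP; split => x //=.
  by rewrite !in_itv/= => -[xl /andP[/lt_le_trans/(_ xl)]]; rewrite ltxx.
by move=> ->; rewrite addrAC subrr add0r (finePK Q mlr).
Qed.

Definition increment N i w : R := B (i.+1%:R / N%:R) w - B (i%:R / N%:R) w.

Lemma measurable_increment N i : measurable_fun setT (increment N i).
Proof. by have [mB _ _ _ _] := brownB; exact: measurable_funB. Qed.

Lemma increment_iid N (A : nat -> set R) : (0 < N)%N ->
  (forall i, measurable (A i)) ->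
  P [set w | forall i, (i < N + N)%N -> A i (increment N i w)] =
  (\prod_(i < N + N) normal_prob 0 (Num.sqrt N%:R^-1) (A i))%E.
Proof.
move=> N0 mA; have [_ _ _ Bnorm Bind] := brownB.
have N0R : 0 < N%:R :> R by rewrite ltr0n.
have step i : i%:R / N%:R < i.+1%:R / N%:R :> R.
  by rewrite ltr_pM2r ?invr_gt0// ltr_nat.
have := Bind (N + N)%N (fun i => i%:R / N%:R) _ (fun i _ => step i) A mA.
rewrite mul0r lexx => /(_ isT) ->.
apply: eq_bigr => i _.
have i0 : 0 <= i%:R / N%:R :> R by rewrite divr_ge0.
rewrite (Bnorm _ _ i0 (step i) _ (mA i)).
suff -> : i.+1%:R / N%:R - i%:R / N%:R = N%:R^-1 :> R by [].
by rewrite -mulrBl -natrB// subSnn mul1r.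
Qed.

Lemma walk_increment N w k : (0 < N)%N ->
  walk N ((increment N)^~ w) k = S w (k%:R / N%:R) - S w 0.
Proof.
move=> N0; have N0R : N%:R != 0 :> R by rewrite pnatr_eq0 -lt0n.
have E i : (N + i)%:R / N%:R = i%:R / N%:R + 1 :> R.
  by rewrite natrD mulrDl divff// addrC.
rewrite /walk -(big_mkord xpredT (fun i => increment N (N + i) w - increment N i w)).
rewrite (eq_bigr (fun i => S w (i.+1%:R / N%:R) - S w (i%:R / N%:R))).
  by rewrite telescope_sumr// mul0r.
by move=> i _; rewrite /increment /slepian -addnS !E; ring.
Qed.

Lemma block_increment N w j : (0 < N)%N ->
  block N ((increment N)^~ w) j = B ((j + N)%:R / N%:R) w - B (j%:R / N%:R) w.
Proof.
move=> N0; rewrite /block -(big_mkord xpredT (fun i => increment N (j + i) w)).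
rewrite (eq_bigr (fun i => B ((j + i.+1)%:R / N%:R) w - B ((j + i)%:R / N%:R) w)).
  by rewrite (telescope_sumr (fun i => B ((j + i)%:R / N%:R) w))// addn0.
by move=> i _; rewrite /increment addnS.
Qed.

Lemma block0_increment N w : (0 < N)%N ->
  block N ((increment N)^~ w) 0 = S w 0.
Proof.
move=> N0; rewrite block_increment// add0n /slepian divff ?pnatr_eq0 -?lt0n//.
by rewrite mul0r add0r.
Qed.

Lemma block1_increment N w : (0 < N)%N ->
  block N ((increment N)^~ w) N = S w 1.
Proof.
move=> N0; rewrite block_increment// /slepian natrD mulrDl.
by rewrite divff ?pnatr_eq0 -?lt0n.
Qed.

(** S(0) and S(1) are exactly the two increments of [B] on the grid with [N = 1]. *)
Lemma slepian_endpoints (C D : set R) : measurable C -> measurable D ->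
  P [set w | C (S w 0) /\ D (S w 1)] = (normal_prob 0 1 C * normal_prob 0 1 D)%E.
Proof.
move=> mC mD.
have := @increment_iid 1 (fun i => if i == 0%N then C else D) isT.
rewrite !big_ord_recl big_ord0 mule1 /= invr1 sqrtr1 => <-; last by move=> i; case: ifP.
congr (P _); apply/seteqP.
have E0 w : increment 1 0 w = S w 0 by rewrite /increment /slepian !divr1 add0r.
have E1 w : increment 1 1 w = S w 1 by rewrite /increment /slepian !divr1.
split => w /= => [[Cw Dw]|H]; last by rewrite -E0 -E1; split; [exact: (H 0%N)|exact: (H 1%N)].
by case=> [|[|//]] _ /=; rewrite ?E0 ?E1.
Qed.

Lemma slepian_endpoints_itv l r c : l <= r ->
  pr [set w | S w 0 <= c /\ l < S w 1 <= r] = std_Phi c * (std_Phi r - std_Phi l).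
Proof.
move=> lr.
have := @slepian_endpoints `]-oo, c] `]l, r] (measurable_itv _) (measurable_itv _).
rewrite std_PhiE normal_prob_itv// -EFinM => /(congr1 fine) /= <-.
by congr (fine (P _)); apply/seteqP; split => w /=; rewrite !in_itv.
Qed.

Lemma slepian_endpoints_le a c :
  pr [set w | S w 0 <= c /\ S w 1 <= a] = std_Phi c * std_Phi a.
Proof.
have := @slepian_endpoints `]-oo, c] `]-oo, a] (measurable_itv _) (measurable_itv _).
rewrite !std_PhiE -EFinM => /(congr1 fine) /= <-.
by congr (fine (P _)); apply/seteqP; split => w /=; rewrite !in_itv.
Qed.

Lemma slepian0_le c : pr [set w | S w 0 <= c] = std_Phi c.
Proof.
have := @slepian_endpoints `]-oo, c] setT (measurable_itv _) measurableT.
have -> : normal_prob 0 1 [set: R] = 1%E.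
  exact: (@probability_setT _ _ _ (normal_prob (0 : R) 1)).
rewrite std_PhiE mule1 => /(congr1 fine) /= <-.
by congr (fine (P _)); apply/seteqP; split => w /=; rewrite !in_itv// => -[].
Qed.

(** The excess is counted from S(0), as the reflection requires. With [m = a - v] or [m = a - u]
    this event encloses, or is enclosed in, the exceedance of the fixed level [a] on the slice. *)
Definition cell_event u v a m : set T :=
  [set w | quadrant u v a (S w 0) (S w 1) /\ exceeds B (fun w => S w 0 + m) w].

Lemma measurable_cell_event u v a m : measurable (cell_event u v a m).
Proof.
apply: measurableI.
  by apply: measurable_quadrant; exact: (measurable_slepian brownB).
apply: (measurable_exceeds brownB).
by apply: measurable_funD => //; exact: (measurable_slepian brownB).
Qed.

Lemma measurable_endpoints_itv l r c :
  measurable [set w | S w 0 <= c /\ l < S w 1 <= r].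
Proof.
have -> : [set w | S w 0 <= c /\ l < S w 1 <= r] = [set w | S w 0 <= cst c w] `&`
    ([set w | cst l w < S w 1] `&` [set w | S w 1 <= cst r w]).
  by apply/seteqP; split => w /=; [case=> ? /andP[]|case=> ? [? ?]; split => //; apply/andP].
by apply: measurableI; [|apply: measurableI];
  [apply: measurable_set_le|apply: measurable_set_lt|apply: measurable_set_le] => //;
  exact: (measurable_slepian brownB).
Qed.

Definition grid_event N u v a m : set T :=
  [set w | exists2 k, (k <= N)%N & first_exceed N m k ((increment N)^~ w) /\
       quadrant u v a (S w 0) (S w 1)].

(** The image of [grid_event] under the swap. As the walk at [k] is close to [m], it is nearly the
    rectangle [u + m < S w 1 <= v + m], [S w 0 <= a - m]. *)
Definition reflected_event N u v a m : set T :=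
  [set w | exists2 k, (k <= N)%N & first_exceed N m k ((increment N)^~ w) /\
       quadrant u v a (S w 1 - walk N ((increment N)^~ w) k)
                      (S w 0 + walk N ((increment N)^~ w) k)].

Lemma reflection_increment N u v a m : (0 < N)%N ->
  P (grid_event N u v a m) = P (reflected_event N u v a m).
Proof.
move=> N0.
have := reflection (measurable_increment N)
  (fun A mA => increment_iid N0 mA) u v a m.
under [X in P X = _]eq_set => w do rewrite block0_increment// block1_increment//.
under [X in _ = P X]eq_set => w do rewrite block0_increment// block1_increment//.
by [].
Qed.

End slepian_law.

(** * Probability of a cell by reflection, from above and from below *)

Section cell_bounds.
Context d (T : measurableType d) (R : realType) (P : probability T R).
Context (B : R -> T -> R).
Hypothesis brownB : is_std_brownian P B.
Local Notation S := (slepian B).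
Local Notation pr A := (fine (P A)).
Local Notation Phi := (@std_Phi R).
Local Notation walkB N w := (walk N ((increment B N)^~ w)).

Lemma measurable_grid_event N u v a m : (0 < N)%N ->
  measurable (grid_event B N u v a m).
Proof.
move=> N0; have -> : grid_event B N u v a m = \bigcup_(k in [set k | (k <= N)%N])
    ([set w | first_exceed N m k ((increment B N)^~ w)] `&`
     [set w | quadrant u v a (S w 0) (S w 1)]) by [].
apply: bigcup_measurable => k /= kN; apply: measurableI.
  exact: (measurable_path_event (measurable_increment brownB N) (measurable_first_exceed m kN)).
by apply: measurable_quadrant; exact: (measurable_slepian brownB).
Qed.

Lemma measurable_reflected_event N u v a m : (0 < N)%N ->
  measurable (reflected_event B N u v a m).
Proof.
move=> N0; have -> : reflected_event B N u v a m = \bigcup_(k in [set k | (k <= N)%N])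
    ([set w | first_exceed N m k ((increment B N)^~ w)] `&`
     [set w | quadrant u v a (S w 1 - walkB N w k) (S w 0 + walkB N w k)]) by [].
apply: bigcup_measurable => k /= kN; apply: measurableI.
  exact: (measurable_path_event (measurable_increment brownB N) (measurable_first_exceed m kN)).
have mW : measurable_fun setT (fun w => walkB N w k).
  apply: (@measurable_sum _ _ _ _ _ _ (fun (i : 'I_k) w => _)) => i.
  by apply: measurable_funB; exact: (measurable_increment brownB).
by apply: measurable_quadrant; [apply: measurable_funB|apply: measurable_funD] => //;
  exact: (measurable_slepian brownB).
Qed.

Lemma cell_event_sub N u v a m eta : (0 < N)%N ->
  cell_event B u v a m `<=` grid_event B N u v a m `|` ~` fine_grid B m eta N.
Proof.
move=> N0 w /= [Q E].
have [[_ /(_ E) [k kN mk]]|nF] := pselect (fine_grid B m eta N w); last by right.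
left; have mk' : m < walkB N w k by rewrite walk_increment// ltrBrDl.
by have [j jk Hj] := first_exceed_exists mk'; exists j => //; exact: leq_trans jk kN.
Qed.

Lemma grid_event_sub N u v a m : (0 < N)%N ->
  grid_event B N u v a m `<=` cell_event B u v a m.
Proof.
move=> N0 w [k kN [[mk _] Q]]; split => //.
exists (k%:R / N%:R); first exact: unit_itv_grid.
by move: mk; rewrite walk_increment// ltrBrDl.
Qed.

Lemma first_exceed_overshoot N m eta k w : (0 < N)%N -> 0 <= m ->
  (k <= N)%N -> fine_grid B m eta N w -> first_exceed N m k ((increment B N)^~ w) ->
  walkB N w k <= m + eta.
Proof.
move=> N0 m0 kN [osc _] [mk Hk]; case: k kN mk Hk => [|k] kN mk Hk.
  (* Index 0 cannot be a first exceedance: the walk starts at 0 and [m >= 0]. At a later index the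
     previous value is at most [m] and one step adds at most [eta]. *)
  by move: mk; rewrite /walk big_ord0 ltNge m0.
have := Hk k (leqnn _); have := osc k kN.
by rewrite !walk_increment// => /ler_normlP[_ osck] Hk'; lra.
Qed.

Lemma reflected_event_sub N u v a m eta : (0 < N)%N -> 0 <= m ->
  reflected_event B N u v a m `<=`
  [set w | S w 0 <= a - m /\ u + m < S w 1 <= v + (m + eta)] `|`
  ~` fine_grid B m eta N.
Proof.
move=> N0 m0 w [k kN [[mk Hk] [Q1 Q2 Q3]]].
have [F|nF] := pselect (fine_grid B m eta N w); last by right.
have := first_exceed_overshoot N0 m0 kN F (conj mk Hk).
by left => /=; split; [lra|apply/andP; split; lra].
Qed.

Lemma sub_reflected_event N u v a m eta : (0 < N)%N -> 0 <= m -> 0 <= eta -> a <= u + m ->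
  [set w | S w 0 <= a - (m + eta) /\ u + (m + eta) < S w 1 <= v + m] `<=`
  reflected_event B N u v a m `|` ~` fine_grid B m eta N.
Proof.
move=> N0 m0 eta0 aum w /= [x1 /andP[y1 y2]].
have [F|nF] := pselect (fine_grid B m eta N w); last by right.
(* An exceedance is automatic here: [a <= u + m] and the bounds on the endpoints give
   [S w 1 - S w 0 > m], so the walk is above [m] at its final index. *)
left; have mN : m < walkB N w N.
  by rewrite walk_increment// divff ?pnatr_eq0 -?lt0n//; lra.
have [k kN Hk] := first_exceed_exists mN; exists k => //; split => //.
have := first_exceed_overshoot N0 m0 kN F Hk; case: Hk => mk _ mk'.
by split; lra.
Qed.

Lemma cell_event_le u v a m : 0 <= m -> u <= v ->
  pr (cell_event B u v a m) <= (Phi (v + m) - Phi (u + m)) * Phi (a - m).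
Proof.
move=> m0 uv; apply/ler_addgt0Pr => e e0.
(* Three errors of size at most [e / 3]: the exceptional set on each side of the reflection, and the
   widening of the interval for S(1) by the overshoot. *)
have e30 : 0 < e / 3 by rewrite divr_gt0.
have [N N0 HN] := fine_grid_fineP brownB m e30 e30.
have mF : measurable (~` fine_grid B m (e / 3) N).
  exact/measurableC/(measurable_fine_grid brownB).
have h1 := finePU_le P (measurable_cell_event brownB u v a m)
  (measurable_grid_event u v a m N0) mF (@cell_event_sub N u v a m (e / 3) N0).
have h2 := finePU_le P (measurable_reflected_event u v a m N0)
  (measurable_endpoints_itv brownB _ _ _) mF (@reflected_event_sub N u v a m (e / 3) N0 m0).
move: h1; rewrite (reflection_increment brownB)// => h1.
move: h2; rewrite (slepian_endpoints_itv brownB); last by lra.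
have [h3 h4 h5] : [/\ 0 <= Phi (a - m), Phi (a - m) <= 1 &
    Phi (v + (m + e / 3)) - Phi (v + m) <= e / 3].
  split; [exact: std_Phi_ge0|exact: std_Phi_le1|].
  by apply: le_trans (std_PhiB_le _) _; lra.
have : Phi (a - m) * (Phi (v + (m + e / 3)) - Phi (v + m)) <= e / 3.
  apply: le_trans (ler_wpM2l h3 h5) _.
  by rewrite ler_piMl// ltW.
by lra.
Qed.

Lemma cell_event_ge u v a m : 0 <= m -> u < v -> a <= u + m ->
  (Phi (v + m) - Phi (u + m)) * Phi (a - m) <= pr (cell_event B u v a m).
Proof.
move=> m0 uv aum; apply/ler_addgt0Pr => e e0.
(* The bound [v - u] keeps the shortened interval for S(1) well ordered; [e / 3] pays for the
   exceptional set and for the shifts by [eta] in the two factors. *)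
pose eta := Num.min (e / 3) (v - u).
have eta0 : 0 < eta by rewrite lt_min divr_gt0// subr_gt0.
have etae : eta <= e / 3 by rewrite ge_min lexx.
have etauv : eta <= v - u by rewrite ge_min lexx orbT.
have [N N0 HN] := fine_grid_fineP brownB m eta0 eta0.
have mF : measurable (~` fine_grid B m eta N).
  exact/measurableC/(measurable_fine_grid brownB).
have h1 := finePU_le P (measurable_endpoints_itv brownB _ _ _)
  (measurable_reflected_event u v a m N0) mF
  (@sub_reflected_event N u v a m eta N0 m0 (ltW eta0) aum).
have h2 := fineP_le P (measurable_grid_event u v a m N0)
  (measurable_cell_event brownB u v a m) (@grid_event_sub N u v a m N0).
move: h2; rewrite (reflection_increment brownB)// => h2.
move: h1; rewrite (slepian_endpoints_itv brownB); last by lra.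
have := @std_PhiB_le R (a - (m + eta)) (a - m); rewrite lerD2l lerN2 => /(_ _).
have := @std_PhiB_le R (u + m) (u + (m + eta)); rewrite lerD2l => /(_ _).
have h3 := std_Phi_ge0 (a - (m + eta)).
have h3' := std_Phi_le1 (a - (m + eta)).
have h5 : 0 <= Phi (v + m) - Phi (u + m) by rewrite subr_ge0 std_Phi_le//; lra.
have h6 : Phi (v + m) - Phi (u + m) <= 1.
  by have := std_Phi_le1 (v + m); have := std_Phi_ge0 (u + m); lra.
rewrite lerDl (ltW eta0) => /(_ isT) p1 /(_ isT) p2 h1.
move: p1 p2 h1 h3 h3' h5 h6.
move: (Phi (v + m)) (Phi (u + m)) (Phi (a - m)) (Phi (a - (m + eta))) (Phi (u + (m + eta))).
move=> A C D D' C' p1 p2 h1 h3 h3' h5 h6.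
(* The two products differ by [(A - C) * D - D' * (A - C') = (A - C) * (D - D') + D' * (C' - C)],
   whose terms are bounded separately. *)
have : (A - C) * (D - D') <= eta.
  have DD' : D - D' <= eta by lra.
  apply: le_trans (ler_wpM2l h5 DD') _; rewrite ler_piMl//; lra.
have : D' * (C' - C) <= eta.
  have CC' : C' - C <= eta by lra.
  apply: le_trans (ler_wpM2l h3 CC') _; rewrite ler_piMl//; lra.
by lra.
Qed.

End cell_bounds.

(** * Summation over slices of S(0) and passage to the limit *)

Section excursion_probability.
Context d (T : measurableType d) (R : realType) (P : probability T R).
Context (B : R -> T -> R).
Hypothesis brownB : is_std_brownian P B.
Context (a : R).
Local Notation S := (slepian B).
Local Notation pr A := (fine (P A)).
Local Notation phi := (@std_phi R).
Local Notation Phi := (@std_Phi R).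
Local Notation G := (@std_Phi_prim R).

Definition strip u v : set T :=
  [set w | quadrant u v a (S w 0) (S w 1) /\ exceeds B (cst a) w].

Definition excursion : set T :=
  [set w | [/\ S w 0 <= a, S w 1 <= a & exceeds B (cst a) w]].

Lemma measurable_strip u v : measurable (strip u v).
Proof.
apply: measurableI; last exact: (measurable_exceeds brownB).
by apply: measurable_quadrant; exact: (measurable_slepian brownB).
Qed.

Lemma measurable_excursion : measurable excursion.
Proof.
have -> : excursion = [set w | S w 0 <= cst a w] `&` [set w | S w 1 <= cst a w] `&`
    exceeds B (cst a).
  by apply/seteqP; split => w /=; [case|case=> -[]].
apply: measurableI; last exact: (measurable_exceeds brownB).
by apply: measurableI; apply: measurable_set_le => //; exact: (measurable_slepian brownB).
Qed.

(** On the slice [S w 0 <= v], so exceeding [a] forces an excess of more than [a - v] over S(0). *)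
Lemma strip_le u v : u <= v -> v <= a ->
  pr (strip u v) <= (Phi a - Phi (u + (a - v))) * Phi v.
Proof.
move=> uv va.
have := @cell_event_le _ _ _ _ _ brownB u v a (a - v) _ uv.
rewrite subrKC subKr subr_ge0 => /(_ va); apply: le_trans.
apply: fineP_le; [exact: measurable_strip|exact: (measurable_cell_event brownB)|].
move=> w [Q [t tI /= at_]]; split => //; exists t => //=.
by case: Q => _ xv _; lra.
Qed.

(** On the slice [u < S w 0], so an excess of more than [a - u] over S(0) passes [a]. With
    [m = a - u] the condition [a <= u + m] of [cell_event_ge] holds with equality. *)
Lemma strip_ge u v : u < v -> u <= a ->
  (Phi (v + (a - u)) - Phi a) * Phi u <= pr (strip u v).
Proof.
move=> uv ua.
have := @cell_event_ge _ _ _ _ _ brownB u v a (a - u) _ uv.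
rewrite subrKC subKr subr_ge0 => /(_ ua (lexx _))/le_trans; apply.
apply: fineP_le; [exact: (measurable_cell_event brownB)|exact: measurable_strip|].
move=> w [Q [t tI /= at_]]; split => //; exists t => //=.
by case: Q => ux _ _; lra.
Qed.

(** By induction on the number of slices of width [e]. The slice ending at [v] contributes at most
    [(Phi a - Phi (a - e)) * Phi v], and [e * Phi v <= G (v + e) - G v] telescopes; the factor [e]
    on the left makes this possible. *)
Lemma strips_le e J : 0 < e ->
  e * pr (strip (a - J%:R * e) a) <=
  (Phi a - Phi (a - e)) * (G (a + e) - G (a + e - J%:R * e)).
Proof.
move=> e0; elim: J => [|J IH].
  rewrite mul0r !subr0 subrr mulr0 (_ : strip a a = set0) ?measure0 ?mulr0//.
  by apply/seteqP; split => // w [[+ + _] _] => /lt_le_trans h /h; rewrite ltxx.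
set v := a - J%:R * e in IH *.
have vE : a - J.+1%:R * e = v - e by rewrite /v -natr1; ring.
have va : v <= a by rewrite /v gerBl mulr_ge0// ltW.
have vev : v - e <= v by rewrite gerBl ltW.
have sub : strip (v - e) a `<=` strip v a `|` strip (v - e) v.
  move=> w [[x1 x2 y] E].
  by have [xv|xv] := leP (S w 0) v; [right|left]; split.
have h1 := finePU_le P (measurable_strip _ _) (measurable_strip _ _)
  (measurable_strip _ _) sub.
have h2 := strip_le vev va.
have E1 : v - e + (a - v) = a - e by ring.
have := std_Phi_primB v (ltW e0); rewrite vE.
have -> : a + e - J.+1%:R * e = v by rewrite /v -natr1; ring.
have E2 : a + e - J%:R * e = v + e by rewrite /v; ring.
rewrite E1 in h2; rewrite E2 in IH.
move=> /andP[h3 _].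
have D0 : 0 <= Phi a - Phi (a - e) by rewrite subr_ge0 std_Phi_le// gerBl ltW.
have h4 := ler_wpM2l D0 h3.
have h5 := ler_wpM2l (ltW e0) h1.
have h6 := ler_wpM2l (ltW e0) h2.
by lra.
Qed.

(** The slice ending at [v] contributes at least [(Phi (a + e) - Phi a) * Phi (v - e)], and
    [e * Phi (v - e)] is at least the increment of [G] over the slice one step further left. *)
Lemma strips_ge e J : 0 < e ->
  (Phi (a + e) - Phi a) * (G (a - e) - G (a - e - J%:R * e)) <=
  e * pr (strip (a - J%:R * e) a).
Proof.
move=> e0; elim: J => [|J IH].
  by rewrite mul0r !subr0 subrr mulr0 mulr_ge0 ?fineP_ge0// ltW.
set v := a - J%:R * e in IH *.
have vE : a - J.+1%:R * e = v - e by rewrite /v -natr1; ring.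
have va : v <= a by rewrite /v gerBl mulr_ge0// ltW.
have vev : v - e < v by rewrite gtrBl.
have uva : v - e <= a by rewrite (le_trans (ltW vev)).
have sub : strip v a `|` strip (v - e) v `<=` strip (v - e) a.
  by move=> w [|] [[x1 x2 y] E]; split => //; split => //; lra.
have disj : strip v a `&` strip (v - e) v = set0.
  apply/seteqP; split => // w [[[x1 _ _] _] [[_ x2 _] _]].
  by move: (lt_le_trans x1 x2); rewrite ltxx.
have h0 := finePU P (measurable_strip v a) (measurable_strip (v - e) v) disj.
have h1 := fineP_le P (measurableU _ _ (measurable_strip v a)
  (measurable_strip (v - e) v)) (measurable_strip _ _) sub.
have h2 := strip_ge vev uva.
have E1 : v + (a - (v - e)) = a + e by ring.
have := std_Phi_primB (v - e - e) (ltW e0); rewrite vE subrK.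
have -> : a - e - J.+1%:R * e = v - e - e by rewrite /v -natr1; ring.
have E2 : a - e - J%:R * e = v - e by rewrite /v; ring.
rewrite E1 in h2; rewrite E2 in IH.
move=> /andP[_ h3].
have D0 : 0 <= Phi (a + e) - Phi a by rewrite subr_ge0 std_Phi_le// lerDl ltW.
have h4 := ler_wpM2l D0 h3.
have h5 := ler_wpM2l (ltW e0) h1.
have h6 := ler_wpM2l (ltW e0) h2.
by rewrite h0 in h5; lra.
Qed.

Lemma exists_subr_muln_le (e y : R) : 0 < e -> exists J : nat, a - J%:R * e <= y.
Proof.
move=> e0; have [J _ HJ] := nbhs_infty_ger ((a - y) / e); exists J.
have /= := HJ J (leqnn J); rewrite ler_pdivrMr//; lra.
Qed.

Lemma excursion_le_step e : 0 < e ->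
  e * pr excursion <= (Phi a - Phi (a - e)) * G (a + e).
Proof.
move=> e0; apply/ler_addgt0Pr => r r0.
(* Starting points below the last slice are neglected; their probability is at most [r / e], which
   becomes [r] once multiplied by [e]. *)
have [y Hy] := std_Phi_small (divr_gt0 r0 e0).
have [J /Hy HJ] := exists_subr_muln_le y e0.
have mS0 : measurable [set w | S w 0 <= a - J%:R * e].
  apply: (@measurable_set_le _ _ _ (S^~ 0) (cst (a - J%:R * e))) => //.
  exact: (measurable_slepian brownB).
have sub : excursion `<=` strip (a - J%:R * e) a `|` [set w | S w 0 <= a - J%:R * e].
  move=> w [x y' E]; have [xl|xl] := leP (S w 0) (a - J%:R * e); first by right.
  by left.
have := finePU_le P measurable_excursion (measurable_strip _ _) mS0 sub.
rewrite (slepian0_le brownB) => h; have {}h := ler_wpM2l (ltW e0) h.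
move: HJ; rewrite ler_pdivlMr// => HJ.
have := strips_le J e0; have := std_Phi_prim_ge0 (a + e - J%:R * e) => h1 h2.
have D0 : 0 <= Phi a - Phi (a - e) by rewrite subr_ge0 std_Phi_le// gerBl ltW.
have := mulr_ge0 D0 h1.
by lra.
Qed.

Lemma excursion_ge_step e : 0 < e ->
  (Phi (a + e) - Phi a) * G (a - e) <= e * pr excursion.
Proof.
move=> e0; apply/ler_addgt0Pr => r r0.
have [y Hy] := std_Phi_prim_small r0.
(* The target [y + e] absorbs the shift by [e] in the argument of [G]. *)
have [J HJ] := exists_subr_muln_le (y + e) e0.
have {}HJ : G (a - e - J%:R * e) <= r by apply: Hy; lra.
have sub : strip (a - J%:R * e) a `<=` excursion by move=> w [[_ x y'] E].
have h := fineP_le P (measurable_strip _ _) measurable_excursion sub.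
have {}h := ler_wpM2l (ltW e0) h.
have := strips_ge J e0.
have D0 : 0 <= Phi (a + e) - Phi a by rewrite subr_ge0 std_Phi_le// lerDl ltW.
have D1 : Phi (a + e) - Phi a <= 1.
  by have := std_Phi_le1 (a + e); have := std_Phi_ge0 a; lra.
have h1 := ler_wpM2l D0 HJ.
have h2 := ler_wpM2r (ltW r0) D1.
by lra.
Qed.

(** Divide the two step bounds by [e] and let [e] tend to 0: the difference quotients of [Phi] tend
    to [phi a], and [G (a + e)], [G (a - e)] tend to [G a]. The limits are carried out with explicit
    errors. *)
Lemma excursion_probability : pr excursion = phi a * G a.
Proof.
have G0 := std_Phi_prim_ge0 a.
have f0 := std_phi_ge0 a; have f1 := std_phi_le1 a.
apply/eqP; rewrite eq_le; apply/andP; split; apply/ler_addgt0Pr => r r0.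
  (* From [(G a + e) * (phi a + e) = G a * phi a + e * (G a + phi a + e)], with [phi a <= 1] and
     [e <= 1], the error is at most [e * (G a + 2)]. *)
  pose e := Num.min 1 (r / (G a + 2)).
  have G2 : 0 < G a + 2 by lra.
  have e0 : 0 < e by rewrite lt_min ltr01 divr_gt0.
  have e1 : e <= 1 by rewrite ge_min lexx.
  have er : e * (G a + 2) <= r by rewrite -ler_pdivlMr// ge_min lexx orbT.
  rewrite -(ler_pM2l e0) (le_trans (excursion_le_step e0))//.
  have [|c /andP[c1 c2] ->] := @std_PhiB_itv R (a - e) a; first by lra.
  have cE : phi c <= phi a + e.
    have /ler_normlP[_] := std_phi_lipschitz c a.
    by rewrite distrC ger0_norm ?subr_ge0//; lra.
  rewrite subKr [phi c * e]mulrC -mulrA ler_pM2l//.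
  have /andP[_] := std_Phi_primB a (ltW e0).
  have := ler_wpM2l (ltW e0) (std_Phi_le1 (a + e)) => h1 h2.
  have GE : G (a + e) <= G a + e by lra.
  have := ler_pM (std_Phi_prim_ge0 (a + e)) (std_phi_ge0 c) GE cE.
  have := ler_wpM2l (ltW e0) e1; have := ler_wpM2l (ltW e0) f1.
  by lra.
(* Here [(phi a - e) * G (a - e)] loses at most [e * phi a + e * G a <= e * (G a + 1)] against
   [phi a * G a]. *)
pose e := r / (G a + 1).
have G1 : 0 < G a + 1 by lra.
have e0 : 0 < e by rewrite divr_gt0.
have er : e * (G a + 1) = r by rewrite divfK// gt_eqF.
rewrite -lerBlDr -(ler_pM2l e0) (le_trans _ (excursion_ge_step e0))//.
have [|c /andP[c1 c2] ->] := @std_PhiB_itv R a (a + e); first by lra.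
have cE : phi a - e <= phi c.
  have /ler_normlP[] := std_phi_lipschitz c a.
  by rewrite ger0_norm ?subr_ge0//; lra.
have -> : a + e - a = e by rewrite addrAC subrr add0r.
rewrite [phi c * e]mulrC -[e * phi c * _]mulrA ler_pM2l//.
have /andP[] := std_Phi_primB (a - e) (ltW e0); rewrite subrK => h1 h2.
have := ler_wpM2l (ltW e0) (std_Phi_le1 a).
have := mulr_ge0 (ltW e0) (std_Phi_ge0 (a - e)) => h3 h4.
have h5 : G (a - e) <= G a by lra.
have h6 : G a - e <= G (a - e) by lra.
have h7 := ler_wpM2r (std_Phi_prim_ge0 (a - e)) cE.
have h8 := ler_wpM2l f0 h6.
have h9 := ler_wpM2l (ltW e0) h5.
have := ler_wpM2l (ltW e0) f1.
by lra.
Qed.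

End excursion_probability.

(** * Removing the excursions from the rectangle of endpoints *)

Unset Implicit Arguments.

(* Slepian process S(t) = B(t+1) - B(t), t in [0,1]. *)
Theorem theorem3p1 (R : realType) (d : measure_display) (T : measurableType d)
  (P : probability T R) (B : R -> T -> R) (a : R) :
  is_std_brownian P B ->
  P [set w | forall t : R, 0 <= t <= 1 -> B (t + 1) w - B t w <= a] =
  (std_Phi a ^+ 2 - a * std_phi a * std_Phi a - std_phi a ^+ 2)%:E.
Proof.
move=> brownB; pose S := slepian B.
set E := [set w | _].
have mS t : measurable_fun setT (S ^~ t) by exact: (measurable_slepian brownB).
have mrect : measurable [set w | S w 0 <= a /\ S w 1 <= a].
  apply: measurableI; [apply: (@measurable_set_le _ _ _ (S^~ 0) (cst a))|
    apply: (@measurable_set_le _ _ _ (S^~ 1) (cst a))]; by [|exact: mS].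
have mX := measurable_excursion brownB a.
(* The times 0 and 1 are among those constrained, so paths staying below [a] are those with both
   endpoints below [a] and no excursion. The two probabilities are [Phi a ^+ 2] and
   [phi a * G a]. *)
have EE : E = [set w | S w 0 <= a /\ S w 1 <= a] `\` excursion B a.
  apply/seteqP; split => w.
    move=> Ew; split; first by split; apply: Ew; rewrite lexx ler01.
    by move=> [_ _ [t tI]]; rewrite ltNge Ew.
  move=> [[x y] nX] t tI; rewrite leNgt; apply/negP => h; apply: nX.
  by split => //; exists t.
have mE : measurable E by rewrite EE; exact: measurableD.
have rectE : [set w | S w 0 <= a /\ S w 1 <= a] = E `|` excursion B a.
  by rewrite EE setUC setDUK// => w [].
have disj : E `&` excursion B a = set0 by rewrite EE setDKI.
have := finePU P mE mX disj; rewrite -rectE (slepian_endpoints_le brownB).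
rewrite (excursion_probability brownB) -(finePK P mE) => h; congr EFin.
by rewrite /std_Phi_prim in h; lra.
Qed.
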